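(* Let $n\ge m\ge1$ and let $A$ be a complex $m\times n$ matrix. If $1\le p\le2$, then $$\|A\|_{S_p}\le m^{1/p}n^{1/2}|A|_\infty.$$ Equality holds if and only if $A\in\mathsf{Had}_{m,n}$.
   Context: For an $m\times n$ complex matrix $A=[a_{ij}]$, $\sigma_1(A)\ge\cdots\ge\sigma_m(A)$ are its singular values (square roots of the eigenvalues of $AA^*$, where $A^*$ is the Hermitian adjoint of $A$), $\|A\|_{S_p}=\left(\sigma_1^p(A)+\cdots+\sigma_m^p(A)\right)^{1/p}$ is the Schatten $p$-norm, and $|A|_\infty=\max_{i,j}|a_{ij}|$. $\mathsf{Had}_{m,n}$ denotes the class of complex $m\times n$ matrices whose entries all have the same modulus and whose rows are pairwise orthogonal (for $m=1$ the orthogonality condition is vacuous).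
   Formalization: ''Equality implies A in Had'' is stated only for p < 2 or m = 1, since for p = 2 and m ≥ 2 it fails (the all-ones matrix attains equality but its rows are not orthogonal); the inequality and ''A in Had implies equality'' are stated for all 1 ≤ p ≤ 2. *)

(* Defs.v *)
From HB Require Import structures.
From mathcomp Require Import all_boot all_order all_algebra.
From mathcomp Require Import spectral complex.
From mathcomp Require Import reals exp.
Set Implicit Arguments.
Unset Strict Implicit.
Unset Printing Implicit Defensive.
Import Order.TTheory GRing.Theory Num.Theory.
Local Open Scope ring_scope.
Local Open Scope sesquilinear_scope.

(* Complex numbers are R[i] over a realType R; the modulus of z is taken with
   values in R, as ComplexField.Normc.normc z. *)

(* The eigenvalues with their algebraic multiplicities, in no specified order
   (see eigenvaluesP). *)
Definition eigenvalues (R : realType) (n : nat) (M : 'M[R[i]]_n) : seq R[i] :=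
  sval (closed_field_poly_normal (char_poly M)).

Lemma eigenvaluesP (R : realType) (n : nat) (M : 'M[R[i]]_n) :
  char_poly M = \prod_(z <- eigenvalues M) ('X - z%:P).
Proof.
rewrite /eigenvalues; case: closed_field_poly_normal => /= s {1}->.
by rewrite (monicP (char_poly_monic M)) scale1r.
Qed.

(* The eigenvalues of A A^* are real and nonnegative, so that taking the real
   part only changes their type from R[i] to R. *)
Definition singular_values (R : realType) (m n : nat) (A : 'M[R[i]]_(m, n)) :
    seq R :=
  sort >=%R [seq Num.sqrt (complex.Re z) | z <- eigenvalues (A *m A ^t*)].

Lemma size_singular_values (R : realType) (m n : nat) (A : 'M[R[i]]_(m, n)) :
  size (singular_values A) = m.
Proof.
rewrite size_sort size_map; apply: succn_inj.
by rewrite -(size_char_poly (A *m A ^t*)) eigenvaluesP size_prod_XsubC.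
Qed.

(* The index starts at 0: the usual sigma_1(A), ..., sigma_m(A) are
   singular_value A 0, ..., singular_value A m.-1. *)
Definition singular_value (R : realType) (m n : nat) (A : 'M[R[i]]_(m, n))
    (k : nat) : R :=
  nth 0 (singular_values A) k.

Definition schatten_norm (R : realType) (m n : nat) (p : R)
    (A : 'M[R[i]]_(m, n)) : R :=
  (\sum_(k < m) singular_value A k `^ p) `^ p^-1.

Definition max_entry (R : realType) (m n : nat) (A : 'M[R[i]]_(m, n)) : R :=
  \big[Num.max/0]_(i < m) \big[Num.max/0]_(j < n)
    ComplexField.Normc.normc (A i j).

(* The common modulus may be 0: the zero matrix belongs to the class. *)
Definition Had (R : realType) (m n : nat) (A : 'M[R[i]]_(m, n)) : Prop :=
  (forall i j i' j', ComplexField.Normc.normc (A i j)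
                   = ComplexField.Normc.normc (A i' j')) /\
  (forall i i', i != i' -> \sum_(k < n) A i k * (A i' k)^* = 0).

(* Main.v *)
(* The squares of the singular values are the eigenvalues d_i of A A^*, and
   their sum is the trace, hence at most m b^2 with b = n^(1/2) |A|_oo, with
   equality iff all entries have the same modulus.  The tangent at 1 to the
   concave function x^(p/2), at x = d_i / b^2, gives
   \sum_i d_i^(p/2) <= m b^p, and for p < 2 equality forces d_i = b^2 for all
   i, i.e. A A^* = b^2 I: the rows are orthogonal. *)

Require Import Defs.
From HB Require Import structures.
From mathcomp Require Import all_boot all_order all_algebra.
From mathcomp Require Import spectral complex.
From mathcomp Require Import reals sequences exp.
From mathcomp Require Import ring lra.
Set Implicit Arguments.
Unset Strict Implicit.
Unset Printing Implicit Defensive.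
Import Order.TTheory GRing.Theory Num.Theory.
Local Open Scope ring_scope.
Local Open Scope sesquilinear_scope.
Local Notation normc := ComplexField.Normc.normc.

Lemma char_poly_conj (R : comUnitRingType) n (P D : 'M[R]_n) :
  P \in unitmx -> char_poly (invmx P *m D *m P) = char_poly D.
Proof.
move=> Pu; rewrite /char_poly /char_poly_mx !map_mxM.
set P' := map_mx _ P; set Q := map_mx _ (invmx P); set D' := map_mx _ D.
have QP : Q *m P' = 1%:M by rewrite -map_mxM mulVmx // map_mx1.
have -> : 'X%:M - Q *m D' *m P' = Q *m ('X%:M - D') *m P'.
  by rewrite mulmxBr mulmxBl mul_mx_scalar -scalemxAl QP scalemx1.
by rewrite !det_mulmx mulrAC -det_mulmx QP det1 mul1r.
Qed.

Lemma mulr_conj_normc (R : realType) (z : R[i]) :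
  z * (z^*)%R = ((normc z) ^+ 2)%:C%C.
Proof. by rewrite -normCK rmorphXn. Qed.

(** [A *m A ^t*] is Hermitian, hence normal, hence unitarily diagonalizable. The diagonal matrix is
    the Gram matrix of [P *m A], so each [d i] is the squared norm of a row of [P *m A]: this is why
    it is real and nonnegative. *)
Lemma gram_spectral (R : realType) m n (A : 'M[R[i]]_(m, n)) :
  exists P : 'M[R[i]]_m, exists d : 'I_m -> R,
  [/\ P \in unitmx,
      forall i, 0 <= d i,
      A *m A ^t* = invmx P *m diag_mx (\row_i (d i)%:C%C) *m P &
      perm_eq (singular_values A) [seq Num.sqrt (d i) | i <- enum 'I_m]].
Proof.
set M := A *m A ^t*; set P := spectralmx M.
have Mn : M \is normalmx.
  by apply/normalmxP; rewrite /M trmx_mul map_mxM trmxCK.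
have Pu : P \in unitmx by exact: spectral_unit.
have Puni : P \is unitarymx by exact: spectral_unitarymx.
have ME := orthomx_spectralP Mn; rewrite -/P in ME.
set D := spectral_diag M in ME.
have DE : diag_mx D = (P *m A) *m (P *m A)^t*.
  rewrite trmx_mul map_mxM !mulmxA -(mulmxA P) -/M {1}ME -(invmx_unitary Puni).
  by rewrite !mulmxA mulmxV // mul1mx mulmxK.
pose d i := \sum_j (normc ((P *m A) i j)) ^+ 2.
have Dd : D = \row_i (d i)%:C%C.
  apply/rowP => i; move/matrixP: DE => /(_ i i).
  rewrite /d; move: (P *m A) => B.
  rewrite !mxE eqxx mulr1n => ->; rewrite rmorph_sum.
  by apply: eq_bigr => j _; rewrite /= -mulr_conj_normc !mxE.
exists P, d; rewrite -Dd; split; [exact: Pu | | exact: ME | ].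
  by move=> i; apply: sumr_ge0 => j _; exact: sqr_ge0.
rewrite /singular_values perm_sort.
have /prod_XsubC_eq : \prod_(z <- eigenvalues M) ('X - z%:P) =
    \prod_(z <- [seq (d i)%:C%C | i <- enum 'I_m]) ('X - z%:P).
  rewrite -eigenvaluesP ME char_poly_conj // char_poly_trig ?diag_mx_is_trig //.
  rewrite big_map big_enum; apply: eq_bigr => i _.
  by rewrite Dd !mxE eqxx mulr1n.
move=> /(perm_map (fun z => Num.sqrt (complex.Re z))).
by rewrite -map_comp.
Qed.

(** Symmetric sums ignore the sorting, so the unsorted [d] can stand in for the singular values. *)
Lemma sum_singular_value (R : realType) m n (A : 'M[R[i]]_(m, n)) (d : 'I_m -> R)
    (f : R -> R) :
  perm_eq (singular_values A) [seq Num.sqrt (d i) | i <- enum 'I_m] ->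
  \sum_(k < m) f (singular_value A k) = \sum_i f (Num.sqrt (d i)).
Proof.
move=> /(perm_big _) e.
transitivity (\sum_(s <- singular_values A) f s).
  by rewrite (big_nth 0) size_singular_values big_mkord.
by rewrite e big_map big_enum.
Qed.

(** Both sides are the trace of [A *m A ^t*], which is invariant under conjugation by [P]. *)
Lemma sum_sqr_entries (R : realType) m n (A : 'M[R[i]]_(m, n)) (P : 'M[R[i]]_m)
    (d : 'I_m -> R) : P \in unitmx ->
  A *m A ^t* = invmx P *m diag_mx (\row_i (d i)%:C%C) *m P ->
  \sum_i d i = \sum_i \sum_j (normc (A i j)) ^+ 2.
Proof.
move=> Pu /(congr1 mxtrace).
rewrite -mulmxA [in RHS]mxtrace_mulC mulmxK // mxtrace_diag => e.
apply: (@complexI R); rewrite !rmorph_sum.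
transitivity (\tr (A *m A ^t*)).
  by rewrite e; apply: eq_bigr => i _; rewrite mxE.
apply: eq_bigr => i _; rewrite mxE rmorph_sum; apply: eq_bigr => j _.
by rewrite /= -mulr_conj_normc !mxE.
Qed.

(** Scalar matrices are fixed by conjugation. This turns the equality case [d i = b ^+ 2] into a
    statement on the Gram matrix of the rows of [A]. *)
Lemma conj_diag_scalar (R : realType) m (M P : 'M[R[i]]_m) (d : 'I_m -> R) (c : R) :
  P \in unitmx -> M = invmx P *m diag_mx (\row_i (d i)%:C%C) *m P ->
  (forall i, d i = c) <-> M = (c%:C%C)%:M.
Proof.
move=> Pu ME; split=> [dc|Mc].
  rewrite ME; have -> : \row_i (d i)%:C%C = const_mx c%:C%C.
    by apply/rowP => i; rewrite !mxE dc.
  by rewrite diag_const_mx mul_mx_scalar -scalemxAl mulVmx // scalemx1.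
move=> i; have : diag_mx (\row_i (d i)%:C%C) = (c%:C%C)%:M.
  transitivity (P *m M *m invmx P).
    by rewrite ME !mulmxA mulmxV // mul1mx mulmxK.
  by rewrite Mc mul_mx_scalar -scalemxAl mulmxV // scalemx1.
by move/matrixP => /(_ i i); rewrite !mxE eqxx !mulr1n => /complexI.
Qed.

(* Writing x = e^t, the gap [1 + q (x - 1) - x^q] is
   [(1 - q) (1 - e^(qt)) + q e^(qt) (e^((1-q)t) - 1)], and [1 + u <= e^u]
   is applied at [u = - q t] and [u = (1 - q) t]. *)
Lemma leif_powR_tangent (R : realType) (q x : R) : 0 < q -> q <= 1 -> 0 <= x ->
  x `^ q <= 1 + q * (x - 1) ?= iff (q == 1) || (x == 1).
Proof.
move=> q0 q1 x0; case: (eqVneq q 1) => [->|qn1] /=.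
  by rewrite powRr1 // mul1r addrC subrK; apply/leif_refl.
case: (eqVneq x 1) => [->|xn1] /=.
  by rewrite powR1 subrr mulr0 addr0; apply/leif_refl.
have {}q1 : q < 1 by rewrite lt_neqAle qn1.
suff lt : x `^ q < 1 + q * (x - 1) by split; [exact: ltW | exact: lt_eqF].
(* The point 0 has no logarithm; there the claim is [0 < 1 - q]. *)
have [x_eq0|xp] : x = 0 \/ 0 < x by move: x0; rewrite le_eqVlt => /orP[/eqP|]; auto.
  by rewrite x_eq0 powR0 ?gt_eqF //; lra.
pose t := ln x; have xE : x = expR t by rewrite lnK.
have tn0 : t != 0 by apply: contraNneq xn1 => t0; rewrite xE t0 expR0.
rewrite xE -expRM.
set u := expR (t * q); have u0 : 0 < u by exact: expR_gt0.
have -> : expR t = u * expR ((1 - q) * t).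
  by rewrite -expRD; congr expR; ring.
have h1 : 1 + (1 - q) * t <= expR ((1 - q) * t) by exact: expR_ge1Dx.
have h2 : 1 + - (t * q) < u^-1.
  by rewrite -expRN; apply: expR_gt1Dx; rewrite oppr_eq0 mulf_neq0 // gt_eqF.
have h3 : u * (1 + - (t * q)) < 1.
  by rewrite -[ltRHS](mulfV (lt0r_neq0 u0)) ltr_pM2l.
have h4 : u * (1 + (1 - q) * t) <= u * expR ((1 - q) * t) by rewrite ler_pM2l.
have h5 : (1 - q) * (u * (1 + - (t * q))) < (1 - q) * 1.
  by rewrite ltr_pM2l // subr_gt0.
have h6 := ler_wpM2l (ltW q0) h4.
(* The terms in [t] cancel, so adding [h5] and [h6] gives [u < 1 - q + q * x]. *)
have e : (1 - q) * (u * (1 - t * q)) + q * (u * (1 + (1 - q) * t)) = u by ring.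
lra.
Qed.

Lemma leif_sum_powR (R : realType) m (d : 'I_m -> R) (b p : R) :
  0 < b -> 0 < p -> p <= 2 -> (forall i, 0 <= d i) ->
  \sum_i d i <= m%:R * b ^+ 2 ->
  \sum_i Num.sqrt (d i) `^ p <= m%:R * b `^ p ?=
    iff [forall i, (p == 2) || (d i == b ^+ 2)]
        && (\sum_i d i == m%:R * b ^+ 2).
Proof.
move=> b0 p0 p2 d0 sd; pose x i := d i / b ^+ 2; pose q := p / 2.
have b2 : 0 < b ^+ 2 by exact: exprn_gt0.
have b2n0 := lt0r_neq0 b2.
have two_n0 : 2 != 0 :> R by rewrite pnatr_eq0.
have x0 i : 0 <= x i by rewrite divr_ge0 // ltW.
have q0 : 0 < q by rewrite divr_gt0.
have bp0 : 0 < b `^ p by exact: powR_gt0.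
have sE i : Num.sqrt (d i) `^ p = b `^ p * x i `^ q.
  have -> : d i = b ^+ 2 * x i by rewrite mulrC divfK ?gt_eqF.
  rewrite sqrtrM ?ltW // sqrtr_sqr gtr0_norm // powRM ?sqrtr_ge0 ?(ltW b0) //.
  by rewrite -powR12_sqrt // -powRrM; congr (_ * _ `^ _); rewrite /q mulrC.
under eq_bigr do rewrite sE; rewrite -mulr_sumr mulrC.
have sumx : \sum_i x i = (\sum_i d i) / b ^+ 2 by rewrite mulr_suml.
have hx : \sum_i x i `^ q <= m%:R ?= iff
    [forall i, (q == 1) || (x i == 1)] && (\sum_i x i == m%:R).
  (* The sum of the tangents lies in between: the first comparison is termwise and yields the
     condition on each [x i], the second uses the bound on the sum and yields the condition on
     [\sum_i x i]. *)
  apply: (@leif_trans _ _ _ (\sum_i (1 + q * (x i - 1)))).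
    apply: leif_sum => i _; apply: leif_powR_tangent => //.
    by rewrite /q ler_pdivrMr // mul1r.
  have -> : \sum_i (1 + q * (x i - 1)) = m%:R + q * (\sum_i x i - m%:R).
    rewrite big_split /= -mulr_sumr big_split /= sumr_const card_ord.
    by rewrite sumrN sumr_const card_ord.
  have le : \sum_i x i <= m%:R by rewrite sumx ler_pdivrMr.
  split; first by rewrite gerDl pmulr_rle0 // subr_le0.
  by rewrite -subr_eq0 addrC addKr mulf_eq0 gt_eqF //= subr_eq0.
have -> : (\sum_i d i == m%:R * b ^+ 2) = (\sum_i x i == m%:R).
  by rewrite sumx (can2_eq (divfK b2n0) (mulfK b2n0)).
have -> : [forall i, (p == 2) || (d i == b ^+ 2)] = [forall i, (q == 1) || (x i == 1)].
  apply: eq_forallb => i; rewrite /q /x !(can2_eq (divfK b2n0) (mulfK b2n0)).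
  by rewrite (can2_eq (divfK two_n0) (mulfK two_n0)) !mul1r.
split; first by rewrite ler_pM2r // hx.
by rewrite (inj_eq (mulIf (lt0r_neq0 bp0))) hx.
Qed.

Section MaxEntry.
Variables (R : realType) (m n : nat) (A : 'M[R[i]]_(m, n)).

Lemma normc_ge0 (z : R[i]) : 0 <= normc z.
Proof. by case: z => a b; exact: sqrtr_ge0. Qed.

Lemma max_entry_ge0 : 0 <= max_entry A.
Proof. by rewrite /max_entry; elim/big_rec: _ => // i x _ x0; rewrite le_max x0 orbT. Qed.

Lemma le_max_entry i j : normc (A i j) <= max_entry A.
Proof.
apply: (le_trans (le_bigmax 0 (fun j => normc (A i j)) j)).
exact: (le_bigmax 0 (fun i => \big[Num.max/0]_j normc (A i j)) i).
Qed.

Lemma max_entry_const c : (0 < m)%N -> (0 < n)%N ->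
  (forall i j, normc (A i j) = c) -> max_entry A = c.
Proof.
move=> m0 n0 Ac; apply/eqP; rewrite eq_le; apply/andP; split; last first.
  by rewrite -(Ac (Ordinal m0) (Ordinal n0)) le_max_entry.
(* The iterated maxima start from 0, so [c] must dominate this base value too. *)
have c0 : 0 <= c by rewrite -(Ac (Ordinal m0) (Ordinal n0)) normc_ge0.
by apply: bigmax_le => // i _; apply: bigmax_le => // j _; rewrite Ac.
Qed.

Lemma leif_sum_sqr_entries :
  \sum_i \sum_j normc (A i j) ^+ 2 <= m%:R * (n%:R * max_entry A ^+ 2) ?=
    iff [forall i, forall j, normc (A i j) == max_entry A].
Proof.
have -> : m%:R * (n%:R * max_entry A ^+ 2) =
    \sum_(i < m) \sum_(j < n) max_entry A ^+ 2.
  by rewrite !mulr_natl !sumr_const !card_ord.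
apply: leif_sum => i _; apply: leif_sum => j _; split.
  by rewrite ler_sqr ?nnegrE ?normc_ge0 ?max_entry_ge0 ?le_max_entry.
by rewrite eqrXn2 ?normc_ge0 ?max_entry_ge0.
Qed.

(** The diagonal of [A *m A ^t*] holds the squared norms of the rows, the rest their inner
    products. *)
Lemma Had_gram : (0 < m)%N -> (0 < n)%N ->
  Had A <-> (forall i j, normc (A i j) = max_entry A) /\
    A *m A ^t* = ((n%:R * max_entry A ^+ 2)%:C%C)%:M.
Proof.
move=> m0 n0; split=> [[eqA orthA]|[eqA gramA]].
  have Amax i j : normc (A i j) = max_entry A.
    by apply/esym/max_entry_const => // i' j'; exact: eqA.
  split=> //; apply/matrixP => i k; rewrite !mxE.
  have [<-|ik] := eqVneq i k.
    transitivity (\sum_(j < n) ((max_entry A) ^+ 2)%:C%C).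
      by apply: eq_bigr => j _; rewrite !mxE mulr_conj_normc Amax.
    by rewrite sumr_const card_ord mulr1n mulr_natl rmorphMn.
  by rewrite mulr0n -[RHS](orthA _ _ ik); apply: eq_bigr => j _; rewrite !mxE.
split=> [i j i' j'|i k ik]; first by rewrite !eqA.
move/matrixP: gramA => /(_ i k); rewrite !mxE (negPf ik) mulr0n => e.
by rewrite -[RHS]e; apply: eq_bigr => j _; rewrite !mxE.
Qed.

End MaxEntry.

(* For p = 2 and m >= 2 equality does not imply A \in Had: the all-ones matrix
   has S_2-norm m^(1/2) n^(1/2).  The equivalence is therefore stated in the
   remaining cases, and the implication from Had to equality in all cases. *)
Theorem theorem18 (R : realType) (m n : nat) (hm : (1 <= m)%N) (hmn : (m <= n)%N)
    (A : 'M[R[i]]_(m, n)) (p : R) (hp1 : 1 <= p) (hp2 : p <= 2) :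
  schatten_norm p A <= m%:R `^ p^-1 * n%:R `^ 2^-1 * max_entry A /\
  (p < 2 \/ m = 1%N ->
     (schatten_norm p A = m%:R `^ p^-1 * n%:R `^ 2^-1 * max_entry A <-> Had A)) /\
  (Had A -> schatten_norm p A = m%:R `^ p^-1 * n%:R `^ 2^-1 * max_entry A).
Proof.
have n0 : (0 < n)%N := leq_trans hm hmn.
have p0 : 0 < p := lt_le_trans ltr01 hp1.
set b := n%:R `^ 2^-1 * max_entry A.
have b_ge0 : 0 <= b by rewrite mulr_ge0 ?powR_ge0 ?max_entry_ge0.
have b2 : b ^+ 2 = n%:R * max_entry A ^+ 2.
  by rewrite exprMn powR12_sqrt // sqr_sqrtr.
have [P [d [Pu d0 gramE sv]]] := gram_spectral A.
have rhsE : m%:R `^ p^-1 * n%:R `^ 2^-1 * max_entry A = (m%:R * b `^ p) `^ p^-1.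
  by rewrite powRM ?powR_ge0 // -powRrM mulfV ?gt_eqF // powRr1 // mulrA.
have -> : schatten_norm p A = (\sum_i Num.sqrt (d i) `^ p) `^ p^-1.
  by rewrite /schatten_norm (sum_singular_value (fun s => s `^ p) sv).
rewrite {}rhsE; set S := \sum_i _.
have S0 : 0 <= S by apply: sumr_ge0 => i _; exact: powR_ge0.
have T0 : 0 <= m%:R * b `^ p by rewrite mulr_ge0 ?powR_ge0.
have Had_eq : Had A -> S = m%:R * b `^ p.
  move=> /(Had_gram A hm n0)[_]; rewrite -b2 => /(conj_diag_scalar _ Pu gramE) db.
  rewrite /S; under eq_bigr do rewrite db sqrtr_sqr ger0_norm //.
  by rewrite sumr_const card_ord mulr_natl.
have [leS eqS] : S <= m%:R * b `^ p /\
    (p < 2 \/ m = 1%N -> S = m%:R * b `^ p -> Had A).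
  (* If the maximum vanishes then [b = 0] and dividing by [b ^+ 2] is meaningless; but then [A] is
     zero and lies in [Had]. *)
  have [a0|a0] := eqVneq (max_entry A) 0.
    suff HA : Had A by rewrite Had_eq.
    have A0 i j : A i j = 0.
      apply: ComplexField.Normc.eq0_normc; apply/eqP.
      by rewrite eq_le normc_ge0 andbT -a0 le_max_entry.
    split=> [i j i' j'|i i' _]; first by rewrite !A0.
    by apply: big1 => k _; rewrite A0 mul0r.
  have b0 : 0 < b.
    by rewrite mulr_gt0 ?powR_gt0 ?ltr0n // lt_neqAle eq_sym a0 max_entry_ge0.
  have sdE := sum_sqr_entries Pu gramE.
  have := leif_sum_sqr_entries A; rewrite -b2 -sdE => -[sd_le sd_eq].
  have [S_le S_eq] := leif_sum_powR b0 p0 hp2 d0 sd_le.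
  split=> // p2m /eqP; rewrite S_eq sd_eq => /andP[/forallP db /forallP Amax].
  have {}Amax i j : normc (A i j) = max_entry A by move/forallP: (Amax i) => /(_ j)/eqP.
  (* For [p < 2] the alternative [p == 2] in [db] is excluded, so every [d i] is [b ^+ 2]. For
     [m = 1] equal moduli suffice, as there are no two distinct rows. *)
  case: p2m => [p2|m1].
    apply/(Had_gram A hm n0); split=> //; rewrite -b2.
    apply/(conj_diag_scalar _ Pu gramE) => i.
    by move: (db i); rewrite (lt_eqF p2) => /eqP.
  split=> [i j i' j'|i i']; first by rewrite !Amax.
  have ord_eq0 (k : 'I_m) : k = 0%N :> nat by case: k => -[|k] //=; rewrite m1.
  by case/eqP; apply: ord_inj; rewrite !ord_eq0.
have pV0 : 0 < p^-1 by rewrite invr_gt0.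
split; first by apply: ge0_ler_powR; rewrite ?nnegrE // ltW.
split=> [p2m|/Had_eq -> //]; split=> [|/Had_eq -> //].
by move=> /(powR_injective pV0 S0 T0); exact: eqS.
Qed.
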